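(* Let $\psi:\mathbb{R}^n\rightrightarrows\mathbb{R}^n$ be a set-valued mapping such that $\psi(x)$ is nonempty, closed and convex for every $x\in\mathbb{R}^n$. Let $V:\mathbb{R}^n\to\mathbb{R}^n$ be Lipschitz continuous with constant $L>0$ and $\eta$-strongly monotone with $\eta>0$. Let $\mu>0$ and $\rho>0$ be constants such that $$\|P_{\psi(r)}(y)-P_{\psi(s)}(y)\|\le\rho\|r-s\|\quad\text{for all } y,r,s\in\mathbb{R}^n,$$ $$\theta:=\eta-\rho-\tfrac12-\tfrac12L^2-\tfrac12\mu^2+\mu\eta>0,\qquad \sqrt{L^2-2\eta\mu+\mu^2}+\rho<\mu,$$ and put $\theta_1:=\dfrac{\theta}{(2L+\rho+\mu)^2}$. Let $\sigma,\tau:[0,+\infty)\to[0,+\infty)$ be locally absolutely continuous functions for which there is a constant $\bar\sigma$ such that for every $t\in[0,+\infty)$: (i) $1<\bar\sigma\le\sigma(t)\le\theta^2\theta_1\tau(t)+1$; (ii) $\dfrac{d}{dt}\left(\dfrac{\sigma(t)}{\tau(t)}\right)\le0$ and $\dot\sigma(t)\le0$; (iii) $\sigma^2(t)-\sigma(t)-\dfrac{2\tau(t)}{\theta_1}\ge0$. Let $a_0,b_0\in\mathbb{R}^n$ and let $x:[0,+\infty)\to\mathbb{R}^n$ be the trajectory (the unique strong global solution) of the second-order dynamical system $$\ddot x(t)+\sigma(t)\dot x(t)+\tau(t)\Big(V(x(t))-P_{\psi(x(t))}\big(V(x(t))-\mu x(t)\big)\Big)=0,\qquad x(0)=a_0,\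 \dot x(0)=b_0.$$ Then $x(t)$ converges exponentially as $t\to+\infty$ to $x^*$, where $x^*$ is the unique solution of the inverse quasi-variational inequality problem for $(V,\psi)$; that is, there exist positive constants $\nu,\zeta$ such that $$\|x(t)-x^*\|\le\nu\|x(0)-x^*\|e^{-\zeta t}\quad\text{for all } t\ge0.$$
   Context: $\langle\cdot,\cdot\rangle$ and $\|\cdot\|$ are the standard inner product and norm of $\mathbb{R}^n$. For a nonempty closed convex set $C\subset\mathbb{R}^n$, $P_C$ is the metric projection onto $C$. $V$ is $\eta$-strongly monotone if $\langle V(y)-V(z),y-z\rangle\ge\eta\|y-z\|^2$ for all $y,z\in\mathbb{R}^n$. Inverse quasi-variational inequality problem (IQVIP) for $(V,\psi)$: find $x^*\in\mathbb{R}^n$ such that $V(x^* )\in\psi(x^* )$ and $\langle x^*,z-V(x^* )\rangle\ge0$ for all $z\in\psi(x^* )$. A function is locally absolutely continuous on $[0,+\infty)$ if it is absolutely continuous on $[0,q]$ for every $0<q<+\infty$. A strong global solution of the dynamical system is a function $x:[0,+\infty)\to\mathbb{R}^n$ such that $x$ and $\dot x$ are locally absolutely continuous, the differential equation holds for almost every $t\in[0,+\infty)$, and $x(0)=a_0$, $\dot x(0)=b_0$.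
   Formalization: The bound with factor ‖x(0)−x*‖ fails when a_0 = x* and b_0 ≠ 0 (it would force x ≡ x* ), so it is proved when a_0 ≠ x* or b_0 = 0; in all cases ‖x(t)−x*‖ ≤ νe^{−ζt} is proved instead. *)

(* Defs.v *)
From HB Require Import structures.
From mathcomp Require Import all_boot all_order all_algebra.
From mathcomp Require Import all_classical all_reals all_analysis.
Set Implicit Arguments.
Unset Strict Implicit.
Unset Printing Implicit Defensive.
Import Order.TTheory GRing.Theory Num.Theory.
Import numFieldNormedType.Exports.
Local Open Scope classical_set_scope.
Local Open Scope ring_scope.

(* Vectors of R^n are row vectors.  The library norm `|u| on 'rV[R]_n is the
   maximum norm, hence the separate Euclidean norm. *)
Definition dot (R : realType) (n : nat) (u v : 'rV[R]_n) : R :=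
  \sum_(i < n) u ord0 i * v ord0 i.

Definition enorm (R : realType) (n : nat) (u : 'rV[R]_n) : R :=
  Num.sqrt (dot u u).

(* The point of C nearest to y; it exists and is unique when C is nonempty,
   closed and convex (the default value 0 is irrelevant in that case). *)
Definition metric_proj (R : realType) (n : nat) (C : set 'rV[R]_n) (y : 'rV[R]_n) :
    'rV[R]_n :=
  xget 0 [set p | C p /\ forall z, C z -> enorm (y - p) <= enorm (y - z)].

Definition lipschitz_map (R : realType) (n : nat) (L : R)
    (V : 'rV[R]_n -> 'rV[R]_n) : Prop :=
  forall y z, enorm (V y - V z) <= L * enorm (y - z).

Definition strongly_monotone (R : realType) (n : nat) (eta : R)
    (V : 'rV[R]_n -> 'rV[R]_n) : Prop :=
  forall y z, eta * enorm (y - z) ^+ 2 <= dot (V y - V z) (y - z).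

Definition iqvip_solution (R : realType) (n : nat) (V : 'rV[R]_n -> 'rV[R]_n)
    (psi : 'rV[R]_n -> set 'rV[R]_n) (x : 'rV[R]_n) : Prop :=
  psi x (V x) /\ forall z, psi x z -> 0 <= dot x (z - V x).

(* Functions on [0, +oo[ are represented by functions on R, of which only the
   values on [0, +oo[ are ever used. *)

(* The finitely many subintervals [u i, w i] do not overlap.  For U = 'rV[R]_n
   the norm is the maximum norm, which yields the same notion as the Euclidean
   norm since the two are equivalent. *)
Definition abs_continuous (R : realType) (U : normedModType R) (a b : R)
    (f : R -> U) : Prop :=
  forall e : R, 0 < e -> exists2 d : R, 0 < d &
    forall (m : nat) (u w : 'I_m -> R),
      (forall i, [/\ a <= u i, u i <= w i & w i <= b]) ->
      (forall i j, i != j -> w i <= u j \/ w j <= u i) ->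
      \sum_(i < m) (w i - u i) < d ->
      \sum_(i < m) `|f (w i) - f (u i)| < e.

Definition loc_abs_continuous (R : realType) (U : normedModType R)
    (f : R -> U) : Prop :=
  forall q : R, 0 < q -> abs_continuous 0 q f.

(* l is the derivative at t of f seen as a function on [0, +oo[; at t = 0 this
   is the right derivative. *)
Definition has_deriv (R : realType) (U : normedModType R) (f : R -> U)
    (t : R) (l : U) : Prop :=
  (fun s => (s - t)^-1 *: (f s - f t)) @ within [set s : R | 0 <= s] t^' --> l.

(* v is the velocity of x: it has to be defined everywhere on [0, +oo[, as it
   is required to be locally absolutely continuous. *)
Definition strong_global_solution (R : realType) (n : nat)
    (V : 'rV[R]_n -> 'rV[R]_n) (psi : 'rV[R]_n -> set 'rV[R]_n) (mu : R)
    (sigma tau : R -> R) (a0 b0 : 'rV[R]_n) (x : R -> 'rV[R]_n) : Prop :=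
  exists v : R -> 'rV[R]_n,
    [/\ loc_abs_continuous x /\ loc_abs_continuous v,
        forall t : R, 0 <= t -> has_deriv x t (v t),
        {ae (@lebesgue_measure R), forall t : R, 0 <= t ->
          exists2 w : 'rV[R]_n, has_deriv v t w &
            w + sigma t *: v t
              + tau t *: (V (x t) - metric_proj (psi (x t)) (V (x t) - mu *: x t))
            = 0},
        x 0 = a0
      & v 0 = b0].

(* Main.v *)
(** The zeros of [residual] are the solutions of the inverse quasi-variational
    inequality, and they are the fixed points of
    [y |-> (P_psi(y) (V y - mu y) - (V y - mu y)) / mu], a contraction because
    [P - id] is nonexpansive for every metric projection [P].  The residual [T]
    satisfies [theta |y - xs|^2 <= <T y, y - xs>] and
    [|T y| <= (2 L + rho + mu) |y - xs|], hence also
    [theta1 |T y|^2 <= <T y, y - xs>].  Put [h = |x - xs|^2 / 2] and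
    [E = h' + (sigma - 1) h + (theta1 / 2) (sigma / tau) |x'|^2].  Splitting
    [tau <T x, x - xs>] into one half bounded below by [h] and one half bounded
    below by [|T x|^2 = |x'' + sigma x'|^2 / tau^2] yields [E' + E <= 0] almost
    everywhere.  So [E] decays like [e^-t], and a second integration, of
    [h' + (sigmabar - 1) h <= E], gives the exponential decay of [h]. *)

Require Import Defs.
From HB Require Import structures.
From mathcomp Require Import all_boot all_order all_algebra.
From mathcomp Require Import all_classical all_reals all_analysis.
From mathcomp Require Import ring lra.
Set Implicit Arguments.
Unset Strict Implicit.
Unset Printing Implicit Defensive.
Import Order.TTheory GRing.Theory Num.Theory.
Import numFieldNormedType.Exports.
Local Open Scope classical_set_scope.
Local Open Scope ring_scope.

(** * Euclidean geometry and metric projections *)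

Section euclidean.
Context {R : realType} {n : nat}.
Implicit Types u v w y z : 'rV[R]_n.

Lemma dotC u v : dot u v = dot v u.
Proof. by apply: eq_bigr => i _; rewrite mulrC. Qed.

Lemma dotDl u v w : dot (u + v) w = dot u w + dot v w.
Proof. by rewrite -big_split; apply: eq_bigr => i _; rewrite mxE mulrDl. Qed.

Lemma dotZl (k : R) u v : dot (k *: u) v = k * dot u v.
Proof. by rewrite mulr_sumr; apply: eq_bigr => i _; rewrite mxE mulrA. Qed.

Lemma dotNl u v : dot (- u) v = - dot u v.
Proof. by rewrite -scaleN1r dotZl mulN1r. Qed.

Lemma dotBl u v w : dot (u - v) w = dot u w - dot v w.
Proof. by rewrite dotDl dotNl. Qed.

Lemma dotDr u v w : dot w (u + v) = dot w u + dot w v.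
Proof. by rewrite dotC dotDl !(dotC w). Qed.

Lemma dotZr (k : R) u v : dot v (k *: u) = k * dot v u.
Proof. by rewrite dotC dotZl dotC. Qed.

Lemma dotNr u v : dot v (- u) = - dot v u.
Proof. by rewrite dotC dotNl dotC. Qed.

Lemma dotBr u v w : dot w (u - v) = dot w u - dot w v.
Proof. by rewrite dotDr dotNr. Qed.

Lemma dot0l u : dot 0 u = 0.
Proof. by rewrite -(scale0r u) dotZl mul0r. Qed.

Lemma dot_subZ (k : R) u v :
  dot (u - k *: v) (u - k *: v) = dot u u - 2 * k * dot u v + k ^+ 2 * dot v v.
Proof. by rewrite !(dotBl, dotBr, dotZl, dotZr) (dotC v u); ring. Qed.

Lemma dotDD u v : dot (u + v) (u + v) = dot u u + 2 * dot u v + dot v v.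
Proof. by rewrite !(dotDl, dotDr) (dotC v u); ring. Qed.

Lemma dot_ge0 u : 0 <= dot u u.
Proof. by apply: sumr_ge0 => i _; rewrite -expr2 sqr_ge0. Qed.

Lemma enorm_ge0 u : 0 <= enorm u.
Proof. exact: sqrtr_ge0. Qed.

Lemma enorm_sqr u : enorm u ^+ 2 = dot u u.
Proof. by rewrite sqr_sqrtr // dot_ge0. Qed.

Lemma normr_le_enorm u : `|u| <= enorm u.
Proof.
rewrite [leLHS]/Num.norm /= mx_normrE; apply/bigmax_leP; split.
  exact: enorm_ge0.
move=> [i j] _ /=; rewrite -(ler_pXn2r (n := 2)) ?nnegrE ?enorm_ge0 //.
rewrite enorm_sqr real_normK ?num_real // /dot (bigD1 j) //= ord1 expr2 lerDl.
by apply: sumr_ge0 => k _; rewrite -expr2 sqr_ge0.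
Qed.

(** The constant is crude, but positive also for [n = 0], so radii can be divided by it. *)
Lemma enorm_le_normr u : enorm u <= n.+1%:R * `|u|.
Proof.
rewrite -(ler_pXn2r (n := 2)) ?nnegrE ?enorm_ge0 ?mulr_ge0 // enorm_sqr exprMn.
apply: (@le_trans _ _ (\sum_(i < n) `|u| ^+ 2)).
  apply: ler_sum => i _; rewrite -expr2 -real_normK ?num_real //.
  rewrite lerXn2r ?nnegrE // [leRHS]/Num.norm /= mx_normrE.
  by apply/bigmax_geP; right; exists (ord0, i).
rewrite sumr_const card_ord -[leLHS]mulr_natl ler_wpM2r ?sqr_ge0 //.
by rewrite -natrX ler_nat (leq_trans (leqnSn n)) // -mulnn leq_pmulr.
Qed.

Lemma enorm_eq0 u : (enorm u == 0) = (u == 0).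
Proof.
apply/eqP/eqP => [u0|->]; last by rewrite /enorm dot0l sqrtr0.
by apply/eqP; rewrite -normr_le0 -u0 normr_le_enorm.
Qed.

Lemma enormN u : enorm (- u) = enorm u.
Proof. by rewrite /enorm dotNl dotNr opprK. Qed.

Lemma enormBC u v : enorm (u - v) = enorm (v - u).
Proof. by rewrite -enormN opprB. Qed.

Lemma enormZ (k : R) u : enorm (k *: u) = `|k| * enorm u.
Proof. by rewrite /enorm dotZl dotZr mulrA -expr2 sqrtrM ?sqr_ge0 // sqrtr_sqr. Qed.

Lemma dot_le_enorm u v : dot u v <= enorm u * enorm v.
Proof.
have [->|u0] := eqVneq u 0; first by rewrite dot0l mulr_ge0 ?enorm_ge0.
have [->|v0] := eqVneq v 0; first by rewrite dotC dot0l mulr_ge0 ?enorm_ge0.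
have a0 : 0 < enorm u by rewrite lt_neqAle enorm_ge0 eq_sym enorm_eq0 u0.
have b0 : 0 < enorm v by rewrite lt_neqAle enorm_ge0 eq_sym enorm_eq0 v0.
(* With a = [enorm u] and b = [enorm v], this square equals 2 a b (a b - <u, v>). *)
have := dot_ge0 (enorm v *: u - enorm u *: v).
rewrite !(dotBl, dotBr, dotZl, dotZr) -!enorm_sqr (dotC v u) => H.
rewrite -(ler_pM2l (mulr_gt0 a0 b0)); move: H.
by rewrite !expr2; lra.
Qed.

Lemma ler_enormD u v : enorm (u + v) <= enorm u + enorm v.
Proof.
rewrite -(ler_pXn2r (n := 2)) ?nnegrE ?addr_ge0 ?enorm_ge0 // sqrrD !enorm_sqr.
by rewrite dotDD; have := dot_le_enorm u v; lra.
Qed.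

Lemma ler_enormB u v w : enorm (u - w) <= enorm (u - v) + enorm (v - w).
Proof. by rewrite -[in leLHS](subrK v u) -addrA ler_enormD. Qed.

Lemma continuous_enormB y : continuous (fun z => enorm (y - z) : R^o).
Proof.
move=> z; apply/(@cvgrPdist_le _ _ _ (nbhs z)) => e e0.
have d0 : 0 < e / n.+1%:R by rewrite divr_gt0.
apply/nbhs_ballP; exists (e / n.+1%:R) => // w; rewrite -ball_normE /= => zw.
apply: (@le_trans _ _ (enorm (z - w))).
  rewrite ler_norml; have := ler_enormB y z w; have := ler_enormB y w z.
  by rewrite (enormBC w z); lra.
by rewrite (le_trans (enorm_le_normr _)) // -ler_pdivlMl // mulrC ltW.
Qed.

End euclidean.

(** * Metric projection onto a nonempty closed convex set *)

Section projection.
Context {R : realType} {n : nat} {C : set 'rV[R]_n}.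
Hypotheses (C_ne : C !=set0) (C_closed : closed C) (C_convex : convex_set C).
Implicit Types y z : 'rV[R]_n.

Lemma nearest_exists y :
  exists p, C p /\ forall z, C z -> enorm (y - p) <= enorm (y - z).
Proof.
have [z0 Cz0] := C_ne.
(* The points of [C] no farther from [y] than [z0] form a compact set; a nearest point of [K] also
   beats every point of [C] outside [K]. *)
pose K := C `&` [set z | enorm (y - z) <= enorm (y - z0)].
have K0 : K !=set0 by exists z0; split=> /=.
have Kcl : closed K.
  apply: closedI => //; apply: (@closed_comp _ R^o (fun z => enorm (y - z) : R^o)
    [set r : R^o | r <= enorm (y - z0)]).
    by move=> z _; exact: continuous_enormB.
  exact: closed_le.
have Kb : bounded_set K.
  exists (enorm (y - z0) + `|y|); split; first exact: num_real.
  move=> M MM z [_ /= yz]; apply: ltW; apply: le_lt_trans MM.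
  rewrite -(subrK y z) (le_trans (ler_normD _ _)) // lerD2r distrC.
  exact: le_trans (normr_le_enorm _) yz.
have [|p /set_mem[Cp py] pmin] := EVT_min_rV (f := fun z => enorm (y - z)) K0
    (bounded_closed_compact Kb Kcl).
  by apply: continuous_subspaceT => z; exact: continuous_enormB.
exists p; split=> // z Cz.
have [yz|/ltW yz] := leP (enorm (y - z)) (enorm (y - z0)).
  by apply: pmin; rewrite inE; split.
exact: le_trans py yz.
Qed.

Lemma metric_proj_in y : C (metric_proj C y).
Proof. by rewrite /metric_proj; case: xgetP => [p _ []//|H]; have [p /H] := nearest_exists y. Qed.

Lemma metric_proj_le y z : C z -> enorm (y - metric_proj C y) <= enorm (y - z).
Proof.
rewrite /metric_proj; case: xgetP => [p _ [_]|H]; first exact.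
by have [p /H] := nearest_exists y.
Qed.

(** A small move from the projection towards [z] stays in [C] by convexity; were the inner product
    positive, it would come closer to [y]. *)
Lemma metric_proj_obtuse y z : C z ->
  dot (y - metric_proj C y) (z - metric_proj C y) <= 0.
Proof.
move=> Cz; set p := metric_proj C y; set q := y - p; set w := z - p.
rewrite leNgt; apply/negP; set d := dot _ _ => d0; set D := dot w w.
have D0 : 0 <= D by exact: dot_ge0.
(* This choice gives [t * (D + 1) <= d], so t^2 D < 2 t d and the squared distance drops strictly.
   The [+ 1] covers [D = 0]. *)
pose t := Num.min 1 (d / (D + 1)).
have t0 : 0 < t by rewrite lt_min ltr01 divr_gt0 //; lra.
have t1 : t <= 1 by rewrite ge_min lexx.
have td : t * (D + 1) <= d by rewrite -ler_pdivlMr ?ge_min ?lexx ?orbT //; lra.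
have Cq : C (p + t *: w).
  have /mem_set := Cz; have /mem_set := metric_proj_in y => Cp' Cz'.
  have := @C_convex z p (Itv01 (ltW t0) t1) Cz' Cp'; rewrite inE /=.
  rewrite /conv /= /unstable.onem scalerBl scale1r /w scalerBr.
  by congr C; rewrite addrC addrAC addrA.
have := metric_proj_le y Cq; rewrite -/p.
rewrite -(ler_pXn2r (n := 2)) ?nnegrE ?enorm_ge0 // !enorm_sqr opprD addrA.
rewrite -/q dot_subZ -/d -/D.
have : t * (t * (D + 1)) <= t * d by rewrite ler_pM2l.
have : 0 < t * d by rewrite mulr_gt0.
have : 0 < t * t by rewrite mulr_gt0.
by lra.
Qed.

(** The obtuseness inequalities at [p] and at the projection [q] add up to |q - p|^2 <= 0. *)
Lemma metric_proj_unique y p : C p ->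
  (forall z, C z -> dot (y - p) (z - p) <= 0) -> metric_proj C y = p.
Proof.
move=> Cp pobt; set q := metric_proj C y.
have := pobt _ (metric_proj_in y); have := metric_proj_obtuse y Cp; rewrite -/q => H1 H2.
suff : dot (q - p) (q - p) <= 0.
  rewrite -enorm_sqr => H; apply/eqP; rewrite -subr_eq0 -enorm_eq0 -sqrf_eq0.
  by rewrite eq_le H sqr_ge0.
by move: H1 H2; rewrite !(dotBl, dotBr) (dotC p q); lra.
Qed.

(* With A = (y - Py) - (z - Pz) and B = Py - Pz, obtuseness says 0 <= <A, B>,
   while y - z = A + B. *)
Lemma metric_proj_nonexpansive y z :
  enorm (metric_proj C y - metric_proj C z) <= enorm (y - z) /\
  enorm ((y - metric_proj C y) - (z - metric_proj C z)) <= enorm (y - z).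
Proof.
set p := metric_proj C y; set q := metric_proj C z.
have H1 : dot (y - p) (q - p) <= 0 by apply: metric_proj_obtuse; exact: metric_proj_in.
have H2 : dot (z - q) (p - q) <= 0 by apply: metric_proj_obtuse; exact: metric_proj_in.
set A := y - p - (z - q); set B := p - q.
have -> : y - z = A + B by rewrite /A /B; apply/rowP => i; rewrite !mxE; ring.
have AB : 0 <= dot A B.
  by rewrite /A dotBl -[B]opprB dotNr opprB; move: H1 H2; rewrite /B; lra.
split; rewrite -(ler_pXn2r (n := 2)) ?nnegrE ?enorm_ge0 // !enorm_sqr;
  rewrite (dotDD A B); have := dot_ge0 A; have := dot_ge0 B; lra.
Qed.

End projection.

(** * Absolutely continuous functions *)

(** Continuous induction: let [c] be the supremum of the points of [a, b] where [P] holds. The step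
    around [c] carries [P] from a point just below [c] to [c + d / 2] or to [b], whichever comes
    first, which forces [c = b]. *)
Lemma creeping (R : realType) (P : R -> Prop) (a b : R) : a <= b -> P a ->
  (forall t, a <= t <= b -> exists2 d : R, 0 < d &
     forall s s', a <= s -> s <= t -> t <= s' -> s' <= b ->
       t - d < s -> s' < t + d -> P s -> P s') ->
  P b.
Proof.
move=> ab Pa step.
pose S := [set t | a <= t <= b /\ P t].
have Sa : S a by split=> //; rewrite lexx.
have supS : has_sup S by split; [exists a|exists b => t [/andP[]]].
set c := sup S.
have ac : a <= c by apply: ub_le_sup => //; exact: supS.2.
have cb : c <= b by apply: ge_sup; [exists a|move=> t [/andP[]]].
have [|d d0 stepc] := step c; first by rewrite ac cb.
have [s [/andP[sa sb] Ps] cs] := sup_adherent d0 supS.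
have sc : s <= c by apply: ub_le_sup; [exact: supS.2|split=> //; rewrite sa].
pose s' := Num.min b (c + d / 2).
have cs' : c <= s' by rewrite le_min cb /=; lra.
have s'b : s' <= b by rewrite ge_min lexx.
have s'd : s' < c + d.
  by apply: (@le_lt_trans _ _ (c + d / 2)); [rewrite ge_min lexx orbT|lra].
have Ps' : P s' by exact: (stepc s).
have : s' <= c by apply: ub_le_sup; [exact: supS.2|split=> //; lra].
by rewrite ge_min => /orP[bc|]; [rewrite (_ : b = s')// /s' min_l //; lra|lra].
Qed.

Lemma is_derive_approx (R : realType) (f : R -> R) (t l e : R) :
  is_derive t (1 : R) (f : R -> R^o) l -> 0 < e ->
  exists2 d : R, 0 < d &
    forall s, `|s - t| < d -> `|f s - f t - l * (s - t)| <= e * `|s - t|.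
Proof.
move=> [df fl] e0.
have : (fun h => h^-1 *: (((f : R -> R^o) \o shift t) (h *: (1 : R)) - f t)) @ 0^'
    --> (l : R^o).
  by rewrite -fl; exact: df.
move=> /cvgrPdist_le /(_ _ e0) /nbhs_ballP [d /= d0 H]; exists d => // s sd.
have [->|st] := eqVneq s t; first by rewrite !subrr mulr0 subrr normr0 mulr0.
have st0 : s - t != 0 by rewrite subr_eq0.
have /= := H (s - t); rewrite -ball_normE /= sub0r normrN => /(_ sd st0).
rewrite /shift /= (_ : (s - t) *: 1 + t = s); last by rewrite /GRing.scale /= mulr1 subrK.
rewrite (_ : l - _ = - ((f s - f t - l * (s - t)) / (s - t))); last first.
  by rewrite /GRing.scale /=; field.
by rewrite normrN normrM normfV ler_pdivrMr // normr_gt0.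
Qed.

(* The derivative is nonpositive off a null set, which is covered by an open
   set U of small measure.  Creeping from a to b, a step either obeys the slope
   bound e or stays in U; the latter steps have small total length, hence
   contribute little by absolute continuity. *)
Lemma ac_nonincreasing (R : realType) (f : R -> R) (a b : R) : a <= b ->
  abs_continuous a b (f : R -> R^o) ->
  {ae (@lebesgue_measure R), forall t : R, a < t < b ->
     exists2 l : R, is_derive t (1 : R) (f : R -> R^o) l & l <= 0} ->
  f b <= f a.
Proof.
move=> ab fac [N [mN N0 PN]].
pose mu : {measure set (measurableTypeR R) -> \bar R} := @lebesgue_measure R.
have muN0 : mu N = 0%E by exact: N0.
apply/ler_addgt0Pr => e0 e00.
(* [e] is used twice: as a slope over the length [b - a], and as a bound on the sum of the
   increments over the steps inside [U]. *)
pose e := e0 / (b - a + 1).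
have ba0 : 0 < b - a + 1 by lra.
have ee : 0 < e by rewrite divr_gt0.
have -> : e0 = e * (b - a) + e by rewrite /e; field; rewrite gt_eqF.
have [d d0 fd] := fac e ee.
(* The endpoints join the null set because the derivative is only given inside ]a, b[. *)
pose D := N `|` [set a] `|` [set b].
have mD : measurable D by apply: measurableU => //; apply: measurableU.
have D0 : mu D = 0%E.
  rewrite /D !measureU0 //; first exact: lebesgue_measure_set1.
    exact: measurableU.
  exact: lebesgue_measure_set1.
have [|U [Uo DU Ud]] := lebesgue_regularity_outer mD _ d0; first by rewrite [X in (X < _)%E]D0.
have mU : measurable U by exact: measurable_realfun.open_measurable.
have muU : (mu U < d%:E)%E.
  by rewrite -(setDUK DU) setUC measureU0 //; exact: measurableD.
(* [G t] is the length budget for the steps inside [U] made up to [t]; it stays below [d]. *)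
pose G t := fine (mu (U `&` `]a, t])).
have muI t : mu (U `&` `]a, t]) \is a fin_num.
  rewrite ge0_fin_numE // (le_lt_trans _ (lt_trans muU (ltry _))) //.
  by rewrite le_measure ?inE //; exact: measurableI.
have Gge0 t : 0 <= G t by rewrite fine_ge0.
have Gd t : G t < d.
  rewrite -lte_fin fineK // (le_lt_trans _ muU) //.
  by rewrite le_measure ?inE //; exact: measurableI.
have Gmono s t : s <= t -> G s <= G t.
  move=> st; rewrite fine_le // le_measure ?inE //; try exact: measurableI.
  by apply: setIS => r /=; rewrite !in_itv /= => /andP[-> /le_trans]; apply.
have Ginc s t : a <= s -> s <= t -> `]s, t] `<=` U -> t - s <= G t - G s.
  move=> sa st sU; rewrite lerBrDl -lee_fin EFinD !fineK //.
  have -> : (t - s)%:E = mu (`]s, t]%classic : set R).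
    rewrite (_ : mu _ = lebesgue_measure (`]s, t]%classic : set R)) //.
    rewrite lebesgue_measure_itv /= lte_fin; case: ltP => // ts.
    by rewrite (@le_anti _ _ s t) ?st // subrr.
  rewrite -measureU //; last 2 first.
    exact: measurableI.
    apply/seteqP; split=> // r /= [[_]].
    by rewrite !in_itv /= => /andP[_ rs] /andP[/lt_le_trans/(_ rs)]; rewrite ltxx.
  rewrite le_measure ?inE //.
  - by apply: measurableU => //; exact: measurableI.
  - exact: measurableI.
  move=> r [[Ur]|rst].
    by rewrite /= !in_itv /= => /andP[-> /le_trans] /(_ _ st) ->.
  split; first exact: sU.
  by move: rst; rewrite /= !in_itv /= => /andP[/(le_lt_trans sa) -> ->].
pose nov (p q : R * R) := (p.2 <= q.1) || (q.2 <= p.1).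
(* Invariant: [f] has grown with slope at most [e], apart from its increments over a list of
   nonoverlapping intervals of total length at most [G t]. *)
pose P t := exists s : seq (R * R),
  [/\ all (fun p => [&& a <= p.1, p.1 <= p.2 & p.2 <= t]) s, pairwise nov s,
    \sum_(p <- s) (p.2 - p.1) <= G t
  & f t <= f a + e * (t - a) + \sum_(p <- s) `|f p.2 - f p.1|].
have [s [sab snov sG sf]] : P b.
  apply: (creeping (P := P) ab).
    by exists [::]; rewrite !big_nil subrr mulr0 !addr0; split.
  move=> t tab; have [tD|tD] := pselect (D t).
    (* Near a point of [D] the step stays in [U]: the interval [(s, s')] joins the list, and the
       growth of [G] pays for its length. *)
    have /nbhs_ballP[r /= r0 rU] : nbhs t U by apply: open_nbhs_nbhs; split=> //; exact: DU.
    exists r => // s s' sa st ts' sb' rs rs' [l [lab lnov lG lf]].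
    exists ((s, s') :: l); split.
    - apply/andP; split; first by rewrite /= sa lexx (le_trans st ts').
      by apply: sub_all lab => p /and3P[-> -> /=]; lra.
    - rewrite /= lnov andbT; apply: sub_all lab => p /and3P[_ _ ps].
      by rewrite /nov ps orbT.
    - suff : s' - s <= G s' - G s by rewrite big_cons /=; lra.
      apply: Ginc => //; first exact: le_trans ts'.
      move=> u; rewrite /= in_itv /= => /andP[su us'].
      by apply: rU; rewrite /ball /= ltr_norml; lra.
    - rewrite big_cons /=; have := ler_norm (f s' - f s).
      have : e * (s - a) <= e * (s' - a) by rewrite ler_pM2l //; lra.
      by lra.
  (* At any other point the derivative is nonpositive; comparing [s] and [s'] with [t] gives f s' -
     f s <= e (s' - s), and the list is unchanged. *)
  have tab' : a < t < b.
    by move: tD; rewrite /D => /not_orP[/not_orP[_ /= ta] /= tb];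
      move: ta tb tab => /eqP ta /eqP tb /andP[]; rewrite !le_eqVlt
      (negPf tb) eq_sym (negPf ta) /= => -> ->.
  have [l fl l0] : exists2 l : R, is_derive t (1 : R) (f : R -> R^o) l & l <= 0.
    have := contra_not (PN t); move=> /(_ _)/contrapT; apply=> //.
    by move=> Nt; apply: tD; left; left.
  have [r r0 fr] := is_derive_approx fl ee.
  exists r => // s s' sa st ts' sb' rs rs' [ll [lab lnov lG lf]].
  exists ll; split=> //.
  - by apply: sub_all lab => p /and3P[-> -> /=]; lra.
  - by apply: (le_trans lG); apply: Gmono; exact: le_trans ts'.
  - have := fr s; have := fr s'.
    rewrite !ltr_norml ?ler_norml (ger0_norm (x := s' - t)) ?subr_ge0 //.
    rewrite (ler0_norm (x := s - t)) ?subr_le0 //.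
    have : l * (s' - t) <= 0 by rewrite mulr_le0_ge0 // subr_ge0.
    have : 0 <= l * (s - t) by rewrite mulr_le0 // subr_le0.
    move=> lt1 lt2 H1 H2.
    have /andP[_ {}H1] : - (e * (s' - t)) <= f s' - f t - l * (s' - t) <= e * (s' - t).
      by apply: H1; lra.
    have /andP[{}H2 _] : - (e * - (s - t)) <= f s - f t - l * (s - t) <= e * - (s - t).
      by apply: H2; lra.
    by lra.
have bd i : (i < size s)%N -> [&& a <= (nth (0, 0) s i).1,
    (nth (0, 0) s i).1 <= (nth (0, 0) s i).2 & (nth (0, 0) s i).2 <= b].
  by move=> si; exact: (allP sab _ (mem_nth _ si)).
(* The listed intervals have total length at most [G b], hence below [d], so absolute continuity
   applies to them. *)
have : \sum_(i < size s) `|f (nth (0, 0) s i).2 - f (nth (0, 0) s i).1| < e.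
  apply: (fd _ (fun i : 'I_(size s) => (nth (0, 0) s i).1)
                 (fun i : 'I_(size s) => (nth (0, 0) s i).2)).
  - by move=> i; have /and3P[] := bd i (ltn_ord i).
  - move=> i j; move/(pairwiseP (0, 0)): snov => nn; rewrite -val_eqE neq_ltn => /orP[ij|ji].
      by have /orP[] := nn i j (ltn_ord _) (ltn_ord _) ij; [left|right].
    by have /orP[] := nn j i (ltn_ord _) (ltn_ord _) ji; [right|left].
  - by apply: le_lt_trans (Gd b); rewrite big_tnth in sG;
      apply: le_trans sG; apply: ler_sum => i _; rewrite !(tnth_nth (0, 0)).
rewrite (big_nth (0, 0)) big_mkord in sf.
by move=> se; apply: (le_trans sf); lra.
Qed.

(** For [t > 0] the restriction to [0, +oo[ is not felt near [t]: increments smaller than [t] keep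
    [h + t] positive. *)
Lemma has_deriv_is_derive (R : realType) (U : normedModType R) (f : R -> U)
    (t : R) (l : U) : 0 < t -> has_deriv f t l -> is_derive t (1 : R) f l.
Proof.
move=> t0 fl.
suff H : (fun h => h^-1 *: ((f \o shift t) (h *: (1 : R)) - f t)) @ 0^' --> l.
  by split; [apply/cvg_ex; exists l|exact/cvg_lim].
apply/cvgrPdist_lt => e e0.
have := fl; rewrite /has_deriv => /cvgrPdist_lt /(_ e e0) /nbhs_ballP[d /= d0 H].
apply/nbhs_ballP; exists (Num.min d t) => /=; first by rewrite lt_min d0.
move=> h; rewrite -ball_normE /= sub0r normrN lt_min => /andP[hd ht] h0.
have := H (h + t);  rewrite -ball_normE /= opprD addrCA subrr addr0 normrN.
have -> : h *: (1 : R) = h by rewrite /GRing.scale /= mulr1.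
rewrite addrK; apply=> //.
- by apply: contra_neq h0 => /(congr1 (fun z => z - t)); rewrite addrK subrr.
- by move: ht; rewrite ltr_norml; lra.
Qed.

Lemma has_deriv_coord (R : realType) (n : nat) (x : R -> 'rV[R]_n) (t : R)
    (v : 'rV[R]_n) (i : 'I_n) :
  has_deriv x t v -> has_deriv (fun s => x s ord0 i : R^o) t (v ord0 i).
Proof.
move=> xv; have := cvg_comp _ _ xv (@coord_continuous R 1 n ord0 i v).
by apply: cvg_trans; apply: near_eq_cvg; apply: nearW => s /=; rewrite !mxE.
Qed.

(** * Closure properties of absolute continuity *)

Section abs_continuous_theory.
Context {R : realType}.
Implicit Types (U : normedModType R) (a b : R).

(** Most closure properties below reduce to this one: it is enough to bound each increment by
    increments of absolutely continuous functions. *)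
Lemma ac_dominated U1 U2 U3 a b (C : R) (f : R -> U1) (g : R -> U2)
    (h : R -> U3) : 0 <= C ->
  (forall u w, a <= u -> u <= w -> w <= b ->
     `|h w - h u| <= C * (`|f w - f u| + `|g w - g u|)) ->
  abs_continuous a b f -> abs_continuous a b g -> abs_continuous a b h.
Proof.
move=> C0 H fac gac e e0.
(* [C + 1] stays positive for [C = 0] and makes the final bound e C / (C + 1) strictly smaller than
   [e]. *)
have e'0 : 0 < e / (2 * (C + 1)) by rewrite divr_gt0 // mulr_gt0 //; lra.
have [d1 d10 H1] := fac _ e'0; have [d2 d20 H2] := gac _ e'0.
exists (Num.min d1 d2); first by rewrite lt_min d10.
move=> m u w uw nov; rewrite lt_min => /andP[/(H1 _ _ _ uw nov) s1 /(H2 _ _ _ uw nov) s2].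
have : \sum_(i < m) `|h (w i) - h (u i)| <=
    C * (\sum_(i < m) `|f (w i) - f (u i)| + \sum_(i < m) `|g (w i) - g (u i)|).
  rewrite -big_split mulr_sumr; apply: ler_sum => i _.
  by have [*] := uw i; exact: H.
move=> /le_lt_trans; apply.
apply: (@le_lt_trans _ _ (C * (e / (2 * (C + 1)) + e / (2 * (C + 1))))).
  by rewrite ler_wpM2l // ltW // ltrD.
have -> : C * (e / (2 * (C + 1)) + e / (2 * (C + 1))) = e * (C / (C + 1)).
  by field; lra.
by rewrite -[ltRHS]mulr1 ltr_pM2l // ltr_pdivrMr; lra.
Qed.

Lemma ac_cst U a b (c : U) : abs_continuous a b (fun=> c).
Proof.
move=> e e0; exists 1 => // m u w _ _ _.
by rewrite big1 // => i _; rewrite subrr normr0.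
Qed.

Lemma ac_lipschitz a b (C : R) (h : R -> R) : 0 <= C ->
  (forall u w, a <= u -> u <= w -> w <= b -> `|h w - h u| <= C * (w - u)) ->
  abs_continuous a b (h : R -> R^o).
Proof.
move=> C0 H; apply: (@ac_dominated R^o R^o R^o a b C id (fun=> 0)) => //.
- move=> u w au uw wb; rewrite subrr normr0 addr0 (le_trans (H _ _ _ _ _)) //.
  by rewrite ler_wpM2l // ler_norm.
- move=> e e0; exists e => // m u w uw _; apply: le_lt_trans; apply: ler_sum => i _.
  by have [_ ? _] := uw i; rewrite ger0_norm // subr_ge0.
- exact: ac_cst.
Qed.

(** With [d] the modulus for 1, creeping by steps shorter than [d] raises the bound by at most 1
    each time. *)
Lemma ac_bounded U a b (f : R -> U) : a <= b -> abs_continuous a b f ->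
  exists2 M : R, 0 <= M & forall t, a <= t <= b -> `|f t| <= M.
Proof.
move=> ab fac; have [d d0 fd] := fac 1 ltr01.
suff [M H] : exists M : R, forall t, a <= t <= b -> `|f t| <= M.
  by exists M => //; apply: le_trans (H a _); rewrite ?lexx.
apply: (creeping (P := fun r => exists M : R, forall t, a <= t <= r -> `|f t| <= M) ab).
  by exists `|f a| => t /le_anti ->.
move=> t tab; exists (d / 2); first by lra.
move=> s s' sa st ts' sb' rs rs' [M H]; exists (M + 1) => r /andP[ar rs'1].
have [rs1|sr] := leP r s; first by have := H r; rewrite ar rs1 => /(_ isT); lra.
have := fd 1%N (fun=> s) (fun=> r); rewrite !big_ord1 => /(_ _ _ _)/ltW -fsr.
have {}fsr : `|f r - f s| <= 1.
  apply: fsr; last by lra.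
    by move=> i; split; lra.
  by move=> i j; rewrite !ord1.
rewrite -(subrK (f s) (f r)) (le_trans (ler_normD _ _)) //.
by have := H s; rewrite sa lexx => /(_ isT); lra.
Qed.

Lemma ac_coord a b n (x : R -> 'rV[R]_n) i : abs_continuous a b x ->
  abs_continuous a b (fun s => x s ord0 i : R^o).
Proof.
move=> xac; apply: (ac_dominated (C := 1) (f := x) (g := x)) => // u w _ _ _.
rewrite mul1r (@le_trans _ _ `|x w - x u|) ?lerDl //.
rewrite (_ : x w ord0 i - _ = (x w - x u) ord0 i); last by rewrite !mxE.
rewrite [leRHS]/Num.norm /= mx_normrE.
by apply/bigmax_geP; right; exists (ord0, i).
Qed.

Lemma acD a b (f g : R -> R) : abs_continuous a b (f : R -> R^o) ->
  abs_continuous a b (g : R -> R^o) ->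
  abs_continuous a b (fun s => f s + g s : R^o).
Proof.
apply: (ac_dominated (C := 1)) => // u w _ _ _.
by rewrite mul1r opprD addrACA ler_normD.
Qed.

Lemma acM a b (f g : R -> R) : a <= b -> abs_continuous a b (f : R -> R^o) ->
  abs_continuous a b (g : R -> R^o) ->
  abs_continuous a b (fun s => f s * g s : R^o).
Proof.
move=> ab fac gac; have [M M0 fM] := ac_bounded ab fac.
have [N N0 gN] := ac_bounded ab gac.
apply: (ac_dominated (C := M + N) (f := f : R -> R^o) (g := g : R -> R^o)) => //; first exact: addr_ge0.
move=> u w au uw wb.
have -> : f w * g w - f u * g u = (f w - f u) * g w + f u * (g w - g u) by ring.
rewrite (le_trans (ler_normD _ _)) // !normrM.
have A : `|f w - f u| * `|g w| <= `|f w - f u| * N.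
  by rewrite ler_wpM2l // gN // wb (le_trans au).
have B : `|f u| * `|g w - g u| <= M * `|g w - g u|.
  by rewrite ler_wpM2r // fM // au (le_trans uw).
have : 0 <= M * `|f w - f u| by rewrite mulr_ge0.
have : 0 <= N * `|g w - g u| by rewrite mulr_ge0.
by lra.
Qed.

Lemma acV a b (c : R) (f : R -> R) : 0 < c ->
  (forall t, a <= t <= b -> c <= f t) -> abs_continuous a b (f : R -> R^o) ->
  abs_continuous a b (fun s => (f s)^-1 : R^o).
Proof.
move=> c0 fc fac.
apply: (ac_dominated (C := c ^- 2) (f := f : R -> R^o) (g := f : R -> R^o)) => //.
  by rewrite invr_ge0 sqr_ge0.
move=> u w au uw wb.
have cu : c <= f u by apply: fc; rewrite au (le_trans uw).
have cw : c <= f w by apply: fc; rewrite wb (le_trans au).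
have u0 := lt_le_trans c0 cu; have w0 := lt_le_trans c0 cw.
have -> : (f w)^-1 - (f u)^-1 = (f w * f u)^-1 * (f u - f w).
  by field; rewrite !gt_eqF.
rewrite normrM (distrC (f u)) (ger0_norm (x := _^-1)); last by rewrite invr_ge0 mulr_ge0 // ltW.
apply: ler_pM => //; first by rewrite invr_ge0 mulr_ge0 // ltW.
- by rewrite lef_pV2 ?posrE ?exprn_gt0 ?mulr_gt0 // expr2 ler_pM // ltW.
- by rewrite lerDl.
Qed.

Lemma ac_sum a b n (F : 'I_n -> R -> R) :
  (forall i, abs_continuous a b (F i : R -> R^o)) ->
  abs_continuous a b (fun s => \sum_(i < n) F i s : R^o).
Proof.
move=> Fac; elim: (index_enum _) => [|i r IH].
  rewrite (_ : (fun s => _) = (fun=> 0 : R^o)); first exact: ac_cst.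
  by apply/funext => s; rewrite big_nil.
rewrite (_ : (fun s => _) = (fun s => F i s + \sum_(j <- r) F j s : R^o)).
  exact: acD.
by apply/funext => s; rewrite big_cons.
Qed.

(** On [0, q] the exponent stays below [|k| * q], where the exponential has slope at most
    [expR (|k| * q)]; the chain rule contributes the factor [|k|]. *)
Lemma ac_expR (k q : R) : abs_continuous 0 q (fun s => expR (k * s) : R^o).
Proof.
apply: (ac_lipschitz (C := expR (`|k| * q) * `|k|)); first by rewrite mulr_ge0 ?expR_ge0.
move=> u w u0 uw wq.
have dexp (x y B : R) : x <= y -> y <= B -> expR y - expR x <= expR B * (y - x).
  move=> xy yB; have := expR_ge1Dx (x - y).
  rewrite -(ler_pM2l (expR_gt0 y)) -expRD (_ : y + (x - y) = x); last by ring.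
  have : expR y * (y - x) <= expR B * (y - x).
    by rewrite ler_wpM2r ?subr_ge0 // ler_expR.
  by lra.
have bd t : 0 <= t -> t <= q -> k * t <= `|k| * q.
  move=> t0 tq; apply: (@le_trans _ _ (`|k| * t)); last by rewrite ler_wpM2l.
  by rewrite ler_wpM2r // ler_norm.
have [kk|kk] := leP (k * u) (k * w).
  rewrite ger0_norm ?subr_ge0 ?ler_expR // (le_trans (dexp (k * u) (k * w) _ kk (bd w _ _))) //; first lra.
  by rewrite -mulrBr -mulrA ler_wpM2l ?expR_ge0 // ler_wpM2r ?subr_ge0 // ler_norm.
rewrite ler0_norm ?opprB; last by rewrite subr_le0 ler_expR ltW.
rewrite (le_trans (dexp (k * w) (k * u) _ (ltW kk) (bd u _ _))) //; first lra.
rewrite -mulrBr -mulrA ler_wpM2l ?expR_ge0 // -opprB mulrN -mulNr.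
by rewrite ler_wpM2r ?subr_ge0 // -normrN ler_norm.
Qed.

End abs_continuous_theory.

(** * Solutions of the inverse quasi-variational inequality *)

(* The displacement enorm (f y - y) attains its minimum on the sublevel set of
   its value at 0, which is compact and stable under f; as f shrinks
   displacements by the factor q, the minimum is 0. *)
Lemma enorm_contraction_fixpoint (R : realType) (n : nat)
    (f : 'rV[R]_n -> 'rV[R]_n) (q : R) : 0 <= q < 1 ->
  (forall y z, enorm (f y - f z) <= q * enorm (y - z)) -> exists p, f p = p.
Proof.
move=> /andP[q0 q1] fq; pose g y : R^o := enorm (f y - y).
have g_lip y z : `|g y - g z| <= 2 * enorm (y - z).
  have H u w : g u - g w <= 2 * enorm (u - w).
    have := ler_enormB (f u) (f w) u; have := ler_enormB (f w) w u.
    have := fq u w; have : q * enorm (u - w) <= enorm (u - w).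
      by rewrite ler_piMl ?enorm_ge0 // ltW.
    by rewrite /g (enormBC w u); lra.
  by rewrite ler_norml H andbT lerNl opprB enormBC H.
have g_cont : continuous g.
  move=> y; apply/(@cvgrPdist_le _ _ _ (nbhs y)) => e e0.
  apply/nbhs_ballP; exists (e / (2 * n.+1%:R)) => [|z] /=; first by rewrite divr_gt0.
  rewrite -ball_normE /= ltr_pdivlMr // => yz.
  by have := g_lip y z; have := enorm_le_normr (y - z); lra.
pose K := [set y | g y <= g 0].
have K0 : K !=set0 by exists 0; exact: lexx.
have Kcl : closed K.
  apply: (@closed_comp _ R^o g [set r : R^o | r <= g 0]).
    by move=> z _; exact: g_cont.
  exact: closed_le.
have Kb : bounded_set K.
  (* Passing through [f y] and [f 0] gives |y| <= g y + q |y| + g 0, and [g y <= g 0] on [K]. *)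
  exists (2 * g 0 / (1 - q)); split; first exact: num_real.
  move=> M MM y; rewrite /K /= => gy; apply: ltW; apply: le_lt_trans MM.
  apply: le_trans (normr_le_enorm y) _; rewrite ler_pdivlMr ?subr_gt0 //.
  have := ler_enormB y (f y) 0; have := ler_enormB (f y) (f 0) 0.
  have := fq y 0; rewrite !subr0; move: gy; rewrite /g (enormBC y) subr0; lra.
have [|p /set_mem Kp pmin] := EVT_min_rV K0 (bounded_closed_compact Kb Kcl) (f := g).
  by apply: continuous_subspaceT => z; exact: g_cont.
have gfp : g (f p) <= q * g p by exact: fq.
have g0 y : 0 <= g y by exact: enorm_ge0.
have gp : g p <= g (f p).
  apply: pmin; apply/mem_set; apply: le_trans Kp; apply: (le_trans gfp).
  by rewrite ler_piMl // ltW.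
exists p; apply/eqP; rewrite -subr_eq0 -enorm_eq0; apply/eqP/le_anti.
rewrite enorm_ge0 andbT; change (g p <= 0).
by rewrite -(pmulr_rle0 _ (_ : 0 < 1 - q)) ?subr_gt0 //; lra.
Qed.

Section iqvip.
Context {R : realType} {n : nat}.
Variables (psi : 'rV[R]_n -> set 'rV[R]_n) (V : 'rV[R]_n -> 'rV[R]_n).
Variables (L eta mu rho : R).
Hypotheses (psi_ne : forall y, psi y !=set0)
  (psi_closed : forall y, closed (psi y))
  (psi_convex : forall y, convex_set (psi y))
  (V_lip : lipschitz_map L V) (V_mono : strongly_monotone eta V)
  (mu_gt0 : 0 < mu)
  (proj_lip : forall y r s : 'rV[R]_n,
     enorm (metric_proj (psi r) y - metric_proj (psi s) y) <= rho * enorm (r - s)).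

Let proj_nonexpansive y :=
  metric_proj_nonexpansive (psi_ne y) (@psi_closed y) (@psi_convex y).

Let W y := V y - mu *: y.

Definition residual y := V y - metric_proj (psi y) (V y - mu *: y).

(** That [V y] is the projection of [V y - mu *: y] means, by obtuseness, - mu <y, z - V y> <= 0 on
    [psi y], which is the variational inequality as [mu] is positive. *)
Lemma iqvip_solutionP y : iqvip_solution V psi y <-> residual y = 0.
Proof.
have e z : dot (V y - mu *: y - V y) (z - V y) = - mu * dot y (z - V y).
  by rewrite addrAC subrr sub0r dotNl dotZl mulNr.
split=> [[Vy ysol]|/subr0_eq Vy].
  rewrite /residual (metric_proj_unique _ _ _ Vy) ?subrr // => z pz.
  by rewrite e mulNr oppr_le0 mulr_ge0 ?ysol // ltW.
split; first by rewrite Vy; exact: metric_proj_in.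
move=> z pz; rewrite -(pmulr_rge0 _ mu_gt0) -oppr_le0 -mulNr -e.
have := metric_proj_obtuse (psi_ne y) (@psi_closed y) (@psi_convex y)
  (V y - mu *: y) pz.
by rewrite -Vy.
Qed.

(** In the expanded square, the Lipschitz bound controls the first term and strong monotonicity,
    multiplied by [mu], the cross term. *)
Lemma sub_scale_sqr_le y z : enorm (W y - W z) ^+ 2 <=
  (L ^+ 2 - 2 * eta * mu + mu ^+ 2) * enorm (y - z) ^+ 2.
Proof.
have -> : W y - W z = (V y - V z) - mu *: (y - z).
  by apply/rowP => i; rewrite !mxE; ring.
rewrite enorm_sqr dot_subZ -!enorm_sqr.
have : enorm (V y - V z) ^+ 2 <= L ^+ 2 * enorm (y - z) ^+ 2.
  by rewrite -exprMn lerXn2r ?nnegrE ?enorm_ge0 ?(le_trans (enorm_ge0 _) (V_lip y z)).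
have : mu * (eta * enorm (y - z) ^+ 2) <= mu * dot (V y - V z) (y - z).
  by rewrite ler_pM2l.
by lra.
Qed.

Lemma iqvip_solution_exists :
  Num.sqrt (L ^+ 2 - 2 * eta * mu + mu ^+ 2) + rho < mu -> 0 <= rho ->
  exists xs, unique (iqvip_solution V psi) xs.
Proof.
set k := Num.sqrt _ => krho rho0.
have k0 : 0 <= k by exact: sqrtr_ge0.
have W_lip y z : enorm (W y - W z) <= k * enorm (y - z).
  rewrite -[leLHS]ger0_norm ?enorm_ge0 // -sqrtr_sqr.
  rewrite (le_trans (ler_wsqrtr (sub_scale_sqr_le y z))) //.
  by rewrite mulrC sqrtrM ?sqr_ge0 // sqrtr_sqr ger0_norm ?enorm_ge0 // mulrC.
pose f y := mu^-1 *: (metric_proj (psi y) (W y) - W y).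
pose q := mu^-1 * (k + rho).
have q1 : 0 <= q < 1.
  apply/andP; split; first by rewrite mulr_ge0 ?invr_ge0 ?addr_ge0 // ltW.
  by rewrite /q mulrC ltr_pdivrMr // mul1r.
have f_lip y z : enorm (f y - f z) <= q * enorm (y - z).
  rewrite -scalerBr enormZ gtr0_norm ?invr_gt0 // -mulrA.
  rewrite ler_pM2l ?invr_gt0 //.
  set a := metric_proj (psi y) (W y); set b := metric_proj (psi z) (W z).
  (* [c] separates two changes: from [a] to [c] the point moves and the set is fixed, from [c] to
     [b] the set moves and the point is fixed. *)
  pose c := metric_proj (psi y) (W z).
  have -> : a - W y - (b - W z) = - ((W y - a) - (W z - c)) + (c - b).
    by apply/rowP => i; rewrite !mxE; ring.
  rewrite (le_trans (ler_enormD _ _)) // enormN mulrDl lerD ?proj_lip //.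
  apply: le_trans (proj_nonexpansive y (W y) (W z)).2 _.
  exact: W_lip.
(* With P the projection onto [psi y], [f y = y] reads P (W y) - W y = mu y, that is P (W y) = V
   y. *)
have fE y : (iqvip_solution V psi y) <-> f y = y.
  rewrite iqvip_solutionP /residual -/(W y) /f.
  split=> [/subr0_eq <-|fy].
    by rewrite /W subKr scalerA mulVf ?scale1r // gt_eqF.
  move: fy => /(congr1 (fun u => mu *: u)).
  rewrite scalerA divff ?scale1r ?gt_eqF // => /eqP.
  by rewrite subr_eq addrC /W subrK => /eqP ->; rewrite subrr.
have [p fp] := enorm_contraction_fixpoint q1 f_lip.
exists p; split=> [|z /fE fz]; first exact/fE.
have := f_lip p z; rewrite fp fz => H; apply/eqP; rewrite -subr_eq0 -enorm_eq0.
apply/eqP/le_anti; rewrite enorm_ge0 andbT.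
have /andP[_ q1'] := q1.
by rewrite -(pmulr_rle0 _ (_ : 0 < 1 - q)) ?subr_gt0 //; lra.
Qed.

(** Subtracting the zero residual at [xs] leaves an increment of [V], a projection increment on the
    fixed set [psi y], and a change of set at the fixed point [W xs]. Each is estimated
    separately. *)
Lemma residual_estimates (xs y : 'rV[R]_n) : residual xs = 0 ->
  (eta - rho - 2^-1 - 2^-1 * L ^+ 2 - 2^-1 * mu ^+ 2 + mu * eta)
    * dot (y - xs) (y - xs) <= dot (residual y) (y - xs) /\
  enorm (residual y) <= (2 * L + rho + mu) * enorm (y - xs).
Proof.
move=> xs0.
pose c := metric_proj (psi y) (W xs).
set a := metric_proj (psi y) (W y); set b := metric_proj (psi xs) (W xs).
have E : residual y = (V y - V xs) - ((a - c) + (c - b)).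
  rewrite -[LHS]subr0 -xs0 /residual -/(W y) -/(W xs) -/a -/b.
  by apply/rowP => i; rewrite !mxE; ring.
have ac : enorm (a - c) <= enorm (W y - W xs).
  exact: (proj_nonexpansive _ _ _).1.
have cb : enorm (c - b) <= rho * enorm (y - xs) by exact: proj_lip.
have d0 := enorm_ge0 (y - xs).
split.
  rewrite E (dotBl (V y - V xs)) (dotDl (a - c)) -enorm_sqr.
  have H1 := V_mono y xs.
  have H2 : dot (c - b) (y - xs) <= rho * enorm (y - xs) ^+ 2.
    apply: le_trans (dot_le_enorm _ _) _.
    by rewrite expr2 mulrA ler_wpM2r.
  have H3 : dot (a - c) (y - xs) <= enorm (W y - W xs) * enorm (y - xs).
    by apply: le_trans (dot_le_enorm _ _) _; rewrite ler_wpM2r.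
  have H4 := sub_scale_sqr_le y xs.
  (* Young's inequality for the product in [H3]; together with [H4] it produces the halves and the
     term [mu * eta] of the constant. *)
  have H5 : 0 <= (enorm (W y - W xs) - enorm (y - xs)) ^+ 2 by exact: sqr_ge0.
  by move: H1 H2 H3 H4 H5; rewrite !expr2; lra.
(* Here the three parts contribute [L], [L + mu] and [rho]. *)
rewrite E; set A := V y - V xs; set B := a - c + (c - b).
have HA : enorm A <= L * enorm (y - xs) by exact: V_lip.
have HB : enorm B <= enorm (W y - W xs) + rho * enorm (y - xs).
  by rewrite (le_trans (ler_enormD _ _)) // lerD.
have HW : enorm (W y - W xs) <= L * enorm (y - xs) + mu * enorm (y - xs).
  have -> : W y - W xs = A + - (mu *: (y - xs)).
    by apply/rowP => i; rewrite !mxE; ring.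
  rewrite (le_trans (ler_enormD _ _)) // enormN enormZ lerD //.
  by rewrite ger0_norm // ltW.
rewrite (le_trans (ler_enormD _ _)) // enormN.
by lra.
Qed.

End iqvip.

(** * Decay of the trajectory *)

(** Lets [filterS] and [filterS3] combine almost everywhere statements. *)
#[local] Instance lebesgue_ae_filter (R : realType) :
  Filter (nbhs (almost_everywhere (@lebesgue_measure R))).
Proof.
exact: (ae_filter_ringOfSetsType
  (@lebesgue_measure R : {measure set (measurableTypeR R) -> \bar R})).
Qed.

Lemma is_derive_expRM (R : realType) (k t : R) :
  is_derive t (1 : R) (fun s => expR (k * s) : R^o) (k * expR (k * t)).
Proof.
have H : is_derive t (1 : R) (fun s => k * s : R^o) k.
  by apply: is_derive_eq; rewrite /GRing.scale /= mulr1.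
have := @is_derive1_comp R expR (fun s => k * s) t _ _ (is_derive_expR _) H.
by rewrite mulrC.
Qed.

(** The product [expR (k * s) * f s] is absolutely continuous with nonpositive derivative almost
    everywhere, hence nonincreasing. *)
Lemma ac_gronwall (R : realType) (k : R) (f : R -> R) :
  loc_abs_continuous (f : R -> R^o) ->
  {ae (@lebesgue_measure R), forall t : R, 0 < t ->
     exists2 l : R, is_derive t (1 : R) (f : R -> R^o) l & l + k * f t <= 0} ->
  forall t, 0 <= t -> f t <= f 0 * expR (- (k * t)).
Proof.
move=> fac fD t; rewrite le_eqVlt => /orP[/eqP <-|t0].
  by rewrite mulr0 oppr0 expR0 mulr1.
rewrite expRN ler_pdivlMr ?expR_gt0 // mulrC.
have := @ac_nonincreasing R (fun s => expR (k * s) * f s) 0 t (ltW t0).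
rewrite mulr0 expR0 mul1r; apply.
  by apply: acM; [exact: ltW|exact: ac_expR|exact: fac].
apply: filterS fD => s fs /andP[s0 _]; have [l fl lk] := fs s0.
exists (expR (k * s) * l + f s * (k * expR (k * s))).
  exact: (is_deriveM (is_derive_expRM k s) fl).
have := expR_ge0 (k * s) => e0.
have : expR (k * s) * (l + k * f s) <= 0 by rewrite mulr_ge0_le0.
by lra.
Qed.

Lemma is_derive_dot (R : realType) (n : nat) (f g : R -> 'rV[R]_n) (t : R)
    (df dg : 'rV[R]_n) : 0 < t -> has_deriv f t df -> has_deriv g t dg ->
  is_derive t (1 : R) (fun s => dot (f s) (g s) : R^o) (dot df (g t) + dot (f t) dg).
Proof.
move=> t0 fd gd.
have H i : is_derive t (1 : R) ((fun s => f s ord0 i) * (fun s => g s ord0 i) : R -> R^o)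
    (f t ord0 i * dg ord0 i + g t ord0 i * df ord0 i).
  apply: (is_deriveM (has_deriv_is_derive t0 _) (has_deriv_is_derive t0 _)).
    exact: has_deriv_coord fd.
  exact: has_deriv_coord gd.
have := is_derive_sum H; rewrite fct_sumE => /is_derive_eq; apply.
by rewrite /dot -big_split /=; apply: eq_bigr => i _; ring.
Qed.

Lemma ac_dot (R : realType) (n : nat) (f g : R -> 'rV[R]_n) (a b : R) : a <= b ->
  abs_continuous a b f -> abs_continuous a b g ->
  abs_continuous a b (fun s => dot (f s) (g s) : R^o).
Proof.
move=> ab fac gac; apply: ac_sum => i.
by apply: acM => //; exact: ac_coord.
Qed.

(* [N], [D], [da], [b], [c] and [T2] stand for |v|^2, |d|^2, <d, v>, <v, w>,
   <d, T> and |T|^2, where d = x - xs, v = x', w = x'' and T is the residual;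
   [ds] and [dr] are the derivatives of sigma and of sigma / tau. *)
Lemma energy_dissipation (R : realFieldType)
    (s t th th1 N D da b c T2 ds dr : R) :
  0 < t -> 0 < th1 -> 0 <= s -> 0 <= N -> 0 <= D -> ds <= 0 -> dr <= 0 ->
  0 <= s ^+ 2 - s - 2 * t / th1 -> (s - 1) * D <= th * t * D ->
  th * D <= c -> th1 * T2 <= c -> 2 * s * b + s ^+ 2 * N <= t ^+ 2 * T2 ->
  N + (- (s * da) - t * c) + (ds * (2^-1 * D) + (s - 1) * da)
    + (th1 / 2 * dr * N + th1 / 2 * (s / t) * (2 * b))
    + (da + (s - 1) * (2^-1 * D) + th1 / 2 * (s / t) * N) <= 0.
Proof.
move=> t0 th10 s0 N0 D0 ds0 dr0 c3 c1 cD cT HT.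
have p0 : 0 < th1 / t by rewrite divr_gt0.
(* The terms in [da] cancel. [A1] spends one half of [t * c] on the term in [b], and [A2] the other
   half on the term [(s - 1) * D / 2]. *)
have A1 : th1 / t * (2 * s * b + s ^+ 2 * N) <= t * c.
  apply: (@le_trans _ _ (th1 / t * (t ^+ 2 * T2))); first by rewrite ler_pM2l.
  have -> : th1 / t * (t ^+ 2 * T2) = t * (th1 * T2) by field; rewrite gt_eqF.
  by rewrite ler_pM2l.
have A2 : t * (th * D) <= t * c by rewrite ler_pM2l.
(* Condition (iii), multiplied by [th1 / t * N]: the [s ^+ 2 * N] gained in [A1] outweighs [N] and
   the last term of the energy. *)
have A3 : N * 2 <= th1 / t * (s ^+ 2 - s) * N.
  have : 0 <= th1 / t * (s ^+ 2 - s - 2 * t / th1) * N.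
    by rewrite mulr_ge0 // mulr_ge0 // ltW.
  have -> : th1 / t * (s ^+ 2 - s - 2 * t / th1) * N =
            th1 / t * (s ^+ 2 - s) * N - N * 2.
    by field; rewrite !gt_eqF.
  by rewrite subr_ge0.
have A4 : ds * D <= 0 by rewrite mulr_le0_ge0.
have A5 : th1 * (dr * N) <= 0.
  by rewrite mulr_ge0_le0 ?(ltW th10) // mulr_le0_ge0.
move: A1 A3; rewrite (_ : th1 / 2 * (s / t) = th1 / t * s / 2); last by ring.
move: (th1 / t) p0 => p p0; lra.
Qed.

(** * Lyapunov energy along the trajectory *)

Section decay.
Context {R : realType} {n : nat}.
Variables (x v : R -> 'rV[R]_n) (xs : 'rV[R]_n) (T : 'rV[R]_n -> 'rV[R]_n).
Variables (sigma tau : R -> R) (th th1 M sb : R).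
Hypotheses (M_gt0 : 0 < M) (th_gt0 : 0 < th) (th1E : th1 = th / M ^+ 2).
Hypothesis T_mono : forall y, th * dot (y - xs) (y - xs) <= dot (T y) (y - xs).
Hypothesis T_lip : forall y, enorm (T y) <= M * enorm (y - xs).
Hypotheses (sb_gt1 : 1 < sb) (sigma_ge : forall t, 0 <= t -> sb <= sigma t).
Hypothesis sigma_le :
  forall t, 0 <= t -> sigma t <= th ^+ 2 * th1 * tau t + 1.
Hypothesis sigma_sqr :
  forall t, 0 <= t -> 0 <= sigma t ^+ 2 - sigma t - 2 * tau t / th1.
Hypotheses (sigma_ac : loc_abs_continuous (sigma : R -> R^o))
  (tau_ac : loc_abs_continuous (tau : R -> R^o)).
Hypotheses (x_ac : loc_abs_continuous x) (v_ac : loc_abs_continuous v).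
Hypothesis x_deriv : forall t : R, 0 <= t -> has_deriv x t (v t).
Hypothesis ode : {ae (@lebesgue_measure R), forall t : R, 0 <= t ->
  exists2 w : 'rV[R]_n, has_deriv v t w &
    w + sigma t *: v t + tau t *: T (x t) = 0}.
Hypothesis ratio_deriv : {ae (@lebesgue_measure R), forall t : R, 0 <= t ->
  exists2 l : R^o,
    has_deriv (fun s => sigma s / tau s : R^o) t l & (l : R) <= 0}.
Hypothesis sigma_deriv : {ae (@lebesgue_measure R), forall t : R, 0 <= t ->
  exists2 l : R^o, has_deriv (sigma : R -> R^o) t l & (l : R) <= 0}.

Let th1_gt0 : 0 < th1. Proof. by rewrite th1E divr_gt0 ?exprn_gt0. Qed.

Let h t := 2^-1 * dot (x t - xs) (x t - xs).

Let h_ge0 (t : R) : 0 <= h t. Proof. by rewrite mulr_ge0 ?dot_ge0 // invr_ge0. Qed.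

(** Condition (i) keeps [tau] uniformly away from 0; this makes [sigma / tau] absolutely continuous
    on bounded intervals. *)
Let tau_ge (t : R) : 0 <= t -> (sb - 1) / (th ^+ 2 * th1) <= tau t.
Proof.
move=> t0; rewrite ler_pdivrMr ?mulr_gt0 ?exprn_gt0 // mulrC.
by have := sigma_ge t0; have := sigma_le t0; lra.
Qed.

Let tau_gt0 (t : R) : 0 <= t -> 0 < tau t.
Proof.
move=> /tau_ge; apply: lt_le_trans.
by rewrite divr_gt0 ?subr_gt0 ?mulr_gt0 ?exprn_gt0.
Qed.

Let xB_deriv (t : R) : 0 <= t -> has_deriv (fun s => x s - xs) t (v t).
Proof.
move=> /x_deriv; rewrite /has_deriv.
rewrite (_ : (fun s => _ *: (x s - xs - _)) = fun s => (s - t)^-1 *: (x s - x t)) //.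
by apply/funext => s; rewrite opprB addrA subrK.
Qed.

Let xB_ac : loc_abs_continuous (fun s => x s - xs).
Proof.
move=> q q0; apply: (ac_dominated (C := 1) (f := x) (g := x)) => //; try exact: x_ac.
by move=> u w _ _ _; rewrite mul1r opprB addrA subrK lerDl.
Qed.

Let h_deriv (t : R) : 0 < t -> is_derive t (1 : R) (h : R -> R^o) (dot (x t - xs) (v t)).
Proof.
move=> t0; have d := xB_deriv (ltW t0).
have := is_deriveM (is_derive_cst (2^-1 : R^o) t 1) (is_derive_dot t0 d d).
move/is_derive_eq; apply.
by rewrite /GRing.scale /= mulr0 addr0 (dotC (v t)); field.
Qed.

Let h_ac : loc_abs_continuous (h : R -> R^o).
Proof.
move=> q q0; apply: acM => //; [exact: ltW|exact: ac_cst|].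
by apply: ac_dot; [exact: ltW|exact: xB_ac|exact: xB_ac].
Qed.

Let energy t := dot (x t - xs) (v t) + (sigma t - 1) * h t
  + th1 / 2 * (sigma t / tau t) * dot (v t) (v t).

Let energy_ac : loc_abs_continuous (energy : R -> R^o).
Proof.
move=> q q0; have q0' := ltW q0.
have r_ac : abs_continuous 0 q (fun t => sigma t / tau t : R^o).
  apply: acM => //; first exact: sigma_ac.
  apply: acV (tau_ac q0); last by move=> t /andP[t0 _]; exact: tau_ge.
  by rewrite divr_gt0 ?subr_gt0 ?mulr_gt0 ?exprn_gt0.
apply: acD; [apply: acD|].
- by apply: ac_dot; [|exact: xB_ac|exact: v_ac].
- apply: acM => //; last exact: h_ac.
  by apply: acD; [exact: sigma_ac|exact: ac_cst].
- apply: acM => //; last by apply: ac_dot => //; exact: v_ac.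
  by apply: acM => //; exact: ac_cst.
Qed.

(** At a point other than [xs], comparing [T_mono] with [T_lip] gives [th <= M], so th^2 th1 = th
    (th / M)^2 <= th. At [xs] both sides vanish. *)
Let sigmaB1_le (t : R) : 0 <= t ->
  (sigma t - 1) * dot (x t - xs) (x t - xs) <= th * tau t * dot (x t - xs) (x t - xs).
Proof.
move=> t0; set d := x t - xs; have [->|d0] := eqVneq d 0; first by rewrite dot0l !mulr0.
have e0 : 0 < enorm d by rewrite lt_neqAle enorm_ge0 eq_sym enorm_eq0 d0.
have D0 : 0 < dot d d by rewrite -enorm_sqr exprn_gt0.
have thM : th <= M.
  rewrite -(ler_pM2r D0) (le_trans (T_mono _)) // (le_trans (dot_le_enorm _ _)) //.
  by rewrite -enorm_sqr expr2 mulrA ler_pM2r // T_lip.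
rewrite ler_pM2r //.
have : sigma t - 1 <= th ^+ 2 * th1 * tau t by have := sigma_le t0; lra.
move/le_trans; apply; rewrite ler_pM2r ?tau_gt0 // expr2 -mulrA ler_piMr ?(ltW th_gt0) //.
rewrite th1E mulrA ler_pdivrMr ?exprn_gt0 // mul1r -expr2.
by rewrite lerXn2r ?nnegrE ?(ltW th_gt0) ?(ltW M_gt0).
Qed.

(** The factor 1 is the rate handed to [ac_gronwall]. *)
Let energy_deriv : {ae (@lebesgue_measure R), forall t : R, 0 < t ->
  exists2 l : R, is_derive t (1 : R) (energy : R -> R^o) l & l + 1 * energy t <= 0}.
Proof.
apply: filterS3 ode ratio_deriv sigma_deriv => t; move: (t : R) => {}t Ho Hr Hs t0.
have t0' := ltW t0.
have [w vw ow] := Ho t0'; have [dr rd dr0] := Hr t0'; have [ds sd ds0] := Hs t0'.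
have dD := is_derive_dot t0 (xB_deriv t0') vw.
have dS := is_deriveM (is_deriveB (has_deriv_is_derive t0 sd)
  (is_derive_cst (1 : R^o) t 1)) (h_deriv t0).
have dR := is_deriveM (is_deriveM (is_derive_cst (th1 / 2 : R^o) t 1)
  (has_deriv_is_derive t0 rd)) (is_derive_dot t0 vw vw).
have := is_deriveD (is_deriveD dD dS) dR.
set l := (X in is_derive _ _ _ X) => dl; exists l; first exact: dl.
have wE : w = - (sigma t *: v t) - tau t *: T (x t).
  by apply/eqP; rewrite -subr_eq0 opprD !opprK addrA ow.
have dT : dot (x t - xs) w =
    - (sigma t * dot (x t - xs) (v t)) - tau t * dot (T (x t)) (x t - xs).
  by rewrite {1}wE (dotBr (- (sigma t *: v t))) dotNr !dotZr (dotC (T (x t))).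
(* The equation gives tau T = - (w + sigma v); the square is expanded and |w|^2 dropped. *)
have T2 : 2 * sigma t * dot (v t) w + sigma t ^+ 2 * dot (v t) (v t) <=
    tau t ^+ 2 * dot (T (x t)) (T (x t)).
  have : tau t *: T (x t) = - (w + sigma t *: v t).
    by rewrite wE addrAC addNr sub0r opprK.
  move/(congr1 (fun u => dot u u)); rewrite !dotZl !dotZr dotNl dotNr opprK dotDD.
  rewrite !dotZr dotZl (dotC w (v t)) !mulrA -!expr2 => ->.
  by have := dot_ge0 w; lra.
(* By [T_lip], th1 |T|^2 <= th1 M^2 |d|^2 = th |d|^2 with d = x - xs. *)
have c2 : th1 * dot (T (x t)) (T (x t)) <= dot (T (x t)) (x t - xs).
  apply: le_trans (T_mono _); rewrite th1E -!enorm_sqr mulrAC -mulrA ler_pM2l //.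
  rewrite ler_pdivrMr ?exprn_gt0 // mulrC -exprMn.
  by rewrite lerXn2r ?nnegrE ?enorm_ge0 ?mulr_ge0 ?enorm_ge0 ?(ltW M_gt0).
have s0 : 0 <= sigma t.
  exact: le_trans (le_trans ler01 (ltW sb_gt1)) (sigma_ge t0').
have := energy_dissipation (dot (x t - xs) (v t)) (tau_gt0 t0') th1_gt0 s0 (dot_ge0 (v t))
  (dot_ge0 (x t - xs)) ds0 dr0 (sigma_sqr t0') (sigmaB1_le t0') (T_mono (x t)) c2 T2.
rewrite -/(h t) -dT; apply: le_trans.
rewrite /l /energy /GRing.scale /= /cst subr0 mulr0 addr0 (dotC w (v t)).
rewrite le_eqVlt; apply/orP; left; apply/eqP.
by rewrite !fctE; ring.
Qed.

Lemma trajectory_decay : exists2 z : R, 0 < z & forall t, 0 <= t ->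
  enorm (x t - xs) <= Num.sqrt (2 * (h 0 + 2 * `|energy 0|)) * expR (- (z * t)).
Proof.
(* The bound [sb - 1] comes from the damping of [h]; the bound 1/2 lets [g] below absorb the forcing
   term. *)
pose k := Num.min (sb - 1) (2^-1).
have k0 : 0 < k by rewrite lt_min subr_gt0 sb_gt1 invr_gt0 ltr0n.
have ksb : k <= sb - 1 by rewrite ge_min lexx.
have k2 : k <= 2^-1 by rewrite ge_min lexx orbT.
exists (k / 2) => [|t t0]; first by rewrite divr_gt0.
set B := `|energy 0|.
(* From h' + k h <= B e^-s, the added term yields g' + k g <= - (1 - 2 k) B e^-s <= 0. *)
pose g s := h s + 2 * B * expR (-1 * s).
have g_ac : loc_abs_continuous (g : R -> R^o).
  move=> q q0; apply: acD; first exact: h_ac.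
  by apply: acM; [exact: ltW|exact: ac_cst|exact: ac_expR].
have B0 : 0 <= B by exact: normr_ge0.
have gD (s : R) : 0 < s -> exists2 l : R, is_derive s (1 : R) (g : R -> R^o) l & l + k * g s <= 0.
  move=> s0; have := is_deriveD (h_deriv s0)
    (is_deriveM (is_derive_cst (2 * B : R^o) s 1) (is_derive_expRM (-1) s)).
  set l := (X in is_derive _ _ _ X) => dl; exists l; first exact: dl.
  rewrite /l /g /GRing.scale /= /cst mulr0 addr0.
  have := ac_gronwall energy_ac energy_deriv (ltW s0).
  rewrite mul1r -(mulN1r s); have : energy 0 * expR (-1 * s) <= B * expR (-1 * s).
    by rewrite ler_wpM2r ?expR_ge0 // ler_norm.
  rewrite {2}/energy.
  have : 0 <= th1 / 2 * (sigma s / tau s) * dot (v s) (v s).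
    have := sigma_ge (ltW s0) => ?.
    rewrite !mulr_ge0 ?dot_ge0 ?invr_ge0 ?(ltW th1_gt0) ?(ltW (tau_gt0 (ltW s0))) //.
    by lra.
  have : k * h s <= (sigma s - 1) * h s.
    by rewrite ler_wpM2r // (le_trans ksb) // lerB // sigma_ge // ltW.
  have : 0 <= (1 - 2 * k) * (B * expR (-1 * s)).
    by rewrite mulr_ge0 ?mulr_ge0 ?expR_ge0 //; lra.
  by lra.
have gt : g t <= g 0 * expR (- (k * t)).
  by apply: ac_gronwall => //; apply: nearW => s; exact: gD.
have ht : dot (x t - xs) (x t - xs) <= 2 * (h 0 + 2 * B) * expR (- (k * t)).
  have : 0 <= 2 * B * expR (-1 * t) by rewrite mulr_ge0 ?expR_ge0 // mulr_ge0.
  by move: gt; rewrite /g mulr0 expR0 mulr1 /h; lra.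
rewrite /enorm (le_trans (ler_wsqrtr ht)) // sqrtrM; last first.
  by rewrite mulr_ge0 // addr_ge0 // mulr_ge0.
(* The square root halves the rate, hence the exponent [k / 2]. *)
have -> : - (k * t) = - (k / 2 * t) + - (k / 2 * t) by field.
by rewrite expRD -expr2 sqrtr_sqr ger0_norm ?expR_ge0.
Qed.

End decay.

(** The bound proportional to |x 0 - xs| is stated for [a0 != xs] or [b0 = 0]: if [a0 = xs] and [b0]
    is nonzero, it would force [x] to stay at [xs], against its initial velocity. The bound with a
    free constant [nu] covers every initial condition. *)
Theorem theorem3p2 (R : realType) (n : nat)
    (psi : 'rV[R]_n -> set 'rV[R]_n) (V : 'rV[R]_n -> 'rV[R]_n)
    (L eta mu rho theta theta1 : R)
    (sigma tau : R -> R) (sigmabar : R)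
    (a0 b0 : 'rV[R]_n) (x : R -> 'rV[R]_n)
    (psi_ne : forall y, psi y !=set0)
    (psi_closed : forall y, closed (psi y))
    (psi_convex : forall y, convex_set (psi y))
    (L_gt0 : 0 < L) (V_lip : lipschitz_map L V)
    (eta_gt0 : 0 < eta) (V_mono : strongly_monotone eta V)
    (mu_gt0 : 0 < mu) (rho_gt0 : 0 < rho)
    (proj_lip : forall y r s : 'rV[R]_n,
        enorm (metric_proj (psi r) y - metric_proj (psi s) y) <= rho * enorm (r - s))
    (thetaE : theta =
        eta - rho - 2^-1 - 2^-1 * L ^+ 2 - 2^-1 * mu ^+ 2 + mu * eta)
    (theta_gt0 : 0 < theta)
    (contr : Num.sqrt (L ^+ 2 - 2 * eta * mu + mu ^+ 2) + rho < mu)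
    (theta1E : theta1 = theta / (2 * L + rho + mu) ^+ 2)
    (sigma_ge0 : forall t : R, 0 <= t -> 0 <= sigma t)
    (tau_ge0 : forall t : R, 0 <= t -> 0 <= tau t)
    (sigma_ac : loc_abs_continuous (sigma : R -> R^o))
    (tau_ac : loc_abs_continuous (tau : R -> R^o))
    (cond_i : forall t : R, 0 <= t ->
        [/\ 1 < sigmabar, sigmabar <= sigma t
          & sigma t <= theta ^+ 2 * theta1 * tau t + 1])
    (cond_ii_ratio : {ae (@lebesgue_measure R), forall t : R, 0 <= t ->
        exists2 l : R^o,
          has_deriv (fun s => sigma s / tau s : R^o) t l & (l : R) <= 0})
    (cond_ii_sigma : {ae (@lebesgue_measure R), forall t : R, 0 <= t ->
        exists2 l : R^o, has_deriv (sigma : R -> R^o) t l & (l : R) <= 0})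
    (cond_iii : forall t : R, 0 <= t ->
        0 <= sigma t ^+ 2 - sigma t - 2 * tau t / theta1)
    (x_sol : strong_global_solution V psi mu sigma tau a0 b0 x) :
  exists xs : 'rV[R]_n,
    [/\ unique (iqvip_solution V psi) xs,
        exists nu zeta : R, [/\ 0 < nu, 0 < zeta &
          forall t : R, 0 <= t ->
            enorm (x t - xs) <= nu * expR (- (zeta * t))]
      & (a0 != xs \/ b0 = 0) ->
        exists nu zeta : R, [/\ 0 < nu, 0 < zeta &
          forall t : R, 0 <= t ->
            enorm (x t - xs) <= nu * enorm (x 0 - xs) * expR (- (zeta * t))]].
Proof.
have [v [[x_ac v_ac] x_deriv ode x0 v0]] := x_sol.
have [xs xs_sol] := iqvip_solution_exists psi_ne psi_closed psi_convex V_lip V_mono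
  mu_gt0 proj_lip contr (ltW rho_gt0).
have xs0 := (iqvip_solutionP V psi_ne psi_closed psi_convex mu_gt0 xs).1 xs_sol.1.
have est y := residual_estimates psi_ne psi_closed psi_convex V_lip V_mono mu_gt0
  proj_lip y xs0.
have M0 : 0 < 2 * L + rho + mu by lra.
have sb1 : 1 < sigmabar by have [] := cond_i 0 (lexx 0).
have Tmono y : theta * dot (y - xs) (y - xs) <= dot (residual psi V mu y) (y - xs).
  by rewrite thetaE (est y).1.
have sge t : 0 <= t -> sigmabar <= sigma t by move=> /cond_i[].
have sle t : 0 <= t -> sigma t <= theta ^+ 2 * theta1 * tau t + 1 by move=> /cond_i[].
have [z z0] := trajectory_decay M0 theta_gt0 theta1E Tmono (fun y => (est y).2)
  sb1 sge sle cond_iii sigma_ac tau_ac x_ac v_ac x_deriv ode cond_ii_ratio cond_ii_sigma.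
rewrite x0 v0; set A := Num.sqrt _ => decay.
have A0 : 0 <= A by exact: sqrtr_ge0.
exists xs; split=> //.
  (* The [+ 1] keeps the constant positive when [A = 0]. *)
  exists (A + 1), z; split=> // [|t t0]; first by lra.
  by rewrite (le_trans (decay t t0)) // ler_wpM2r ?expR_ge0 // lerDl.
have [a0xs|a0xs] := eqVneq a0 xs => [[//|b00]|_].
  (* A start at rest in [xs] has zero initial energy, so the trajectory stays there and any positive
     [nu] works. *)
  have A_eq0 : A = 0.
    by rewrite /A a0xs b00 subrr !dot0l !(normr0, mulr0, addr0) sqrtr0.
  exists 1, z; split=> // t t0; apply: le_trans (decay t t0) _.
  by rewrite A_eq0 mul0r mul1r mulr_ge0 ?enorm_ge0 ?expR_ge0.
have e0 : 0 < enorm (a0 - xs).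
  by rewrite lt_neqAle enorm_ge0 eq_sym enorm_eq0 subr_eq0 a0xs.
exists ((A + 1) / enorm (a0 - xs)), z; split=> // [|t t0].
  by rewrite divr_gt0 //; lra.
rewrite divfK ?gt_eqF // (le_trans (decay t t0)) // ler_wpM2r ?expR_ge0 //.
by rewrite lerDl.
Qed.
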